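(* Call a traceless Hermitian $2^n\times2^n$ matrix $\bar H$ locally invertible by individual $z$-rotations if there are angles $\phi_1,\dots,\phi_n\in\mathbb R$ such that $K_z:=\bigotimes_{\ell=1}^n e^{-i\phi_\ell\sigma_z/2}$ satisfies $K_z\bar HK_z^{-1}=-\bar H$. Then: (1) any Hamiltonian $H$ on the local unitary orbit $\operatorname{Ad}_{\mathbf K}(\bar H)=\{K\bar HK^{-1}:K\in\mathbf K\}$ of any such $\bar H$ generates a one-parameter unitary group $\{e^{-itH}:t\in\mathbb R\}$ that is locally invertible of type I; (2) conversely, any type-I locally invertible Hamiltonian $H$ is on the local unitary orbit of some such $\bar H$.
   Context: $\mathbf K:=\mathbf{SU}(2)^{\otimes n}:=\{K_1\otimes\cdots\otimes K_n:K_\ell\in\mathbf{SU}(2)\}$; $\sigma_z=\mathrm{diag}(1,-1)$. A Hamiltonian (traceless Hermitian $2^n\times 2^n$ matrix) $H$, or the group it generates, is locally invertible of type I if there is $K\in\mathbf K$ with $KHK^{-1}=-H$, equivalently $Ke^{-itH}K^{-1}=e^{+itH}$ for all $t\in\mathbb R$. *)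

(* Defs.v *)
From HB Require Import structures.
From mathcomp Require Import all_boot all_order all_algebra.
From mathcomp Require Import all_classical all_reals all_analysis.
From mathcomp Require Import complex mxtens.

Set Implicit Arguments.
Unset Strict Implicit.
Unset Printing Implicit Defensive.

Import Order.TTheory GRing.Theory Num.Theory.
Import numFieldNormedType.Exports.

Local Open Scope classical_set_scope.
Local Open Scope ring_scope.
Local Open Scope sesquilinear_scope.

Section ComplexMatrices.
Variable C : numClosedFieldType.

(* Sum of the exponential series for the topology of 'M[C]_m. *)
Definition expmx (m : nat) (A : 'M[C]_m) : 'M[C]_m :=
  lim (series (fun k : nat => (k`!%:R : C)^-1 *: A ^+ k) @ \oo).

Definition SU (m : nat) : set 'M[C]_m :=
  [set K | K \is unitarymx /\ \det K = 1].

(* Kronecker product of the K l, in increasing order of l; the empty product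
   is the 1 x 1 identity.  The cast is along 2 * 2 ^ n = 2 ^ n.+1. *)
Fixpoint bigtens (n : nat) : ('I_n -> 'M[C]_2) -> 'M[C]_(2 ^ n) :=
  match n with
  | 0 => fun=> 1%:M
  | n'.+1 => fun K =>
      castmx (esym (expnS 2 n'), esym (expnS 2 n'))
        (tensmx (K ord0) (bigtens (fun l => K (lift ord0 l))))
  end.

Definition localSU (n : nat) : set 'M[C]_(2 ^ n) :=
  [set K | exists2 Kl : 'I_n -> 'M[C]_2,
     (forall l, SU (Kl l)) & K = bigtens Kl].

Definition hamiltonian (m : nat) (H : 'M[C]_m) : Prop :=
  H \is hermsymmx /\ \tr H = 0.

Definition Ad (m : nat) (K H : 'M[C]_m) : 'M[C]_m := K *m H *m invmx K.

Definition local_orbit (n : nat) (H : 'M[C]_(2 ^ n)) : set 'M[C]_(2 ^ n) :=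
  [set Ad K H | K in @localSU n].

Definition sigma_z : 'M[C]_2 :=
  diag_mx (\row_(j < 2) if j == ord0 then 1 else -1).

Definition locally_invertible_typeI (n : nat) (H : 'M[C]_(2 ^ n)) : Prop :=
  exists2 K, localSU K & Ad K H = - H.

End ComplexMatrices.

(* The complex numbers R[i], seen through their numClosedFieldType structure:
   MathComp-Analysis infers the topology from this structure, and not from the
   bare type R[i]. *)
Definition Cplx (R : realType) : numClosedFieldType := R[i].

Definition of_real (R : realType) (x : R) : Cplx R := (x%:C)%C.

Section RealParameters.
Variable R : realType.
Local Notation C := (Cplx R).

(* e^{-i phi sigma_z / 2} *)
Definition z_rotation (phi : R) : 'M[C]_2 :=
  expmx (- ('i * of_real (phi / 2)) *: sigma_z C).

Definition invertible_by_z_rotations (n : nat) (H : 'M[C]_(2 ^ n)) : Prop :=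
  exists phi : 'I_n -> R, Ad (bigtens (fun l => z_rotation (phi l))) H = - H.

(* e^{-itH} *)
Definition evolution (m : nat) (H : 'M[C]_m) (t : R) : 'M[C]_m :=
  expmx (- ('i * of_real t) *: H).

Definition one_parameter_unitary_group (m : nat) (U : R -> 'M[C]_m) : Prop :=
  [/\ forall t, U t \is unitarymx,
      U 0 = 1%:M,
      forall s t, U (s + t) = U s *m U t
    & continuous U].

(* The property for the generated group: K e^{-itH} K^-1 = e^{+itH}, with the
   same K for all t. *)
Definition group_locally_invertible_typeI (n : nat) (H : 'M[C]_(2 ^ n)) :
    Prop :=
  exists2 K, localSU K &
    forall t : R, Ad K (evolution H t) = expmx (('i * of_real t) *: H).

End RealParameters.

(* Main.v *)
(* If Kz inverts Hbar and H = K Hbar K^-1, then K Kz K^-1 inverts H.  Conversely,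
   let K = K_1 (x) ... (x) K_n invert H.  Each K_l is V_l^-1 Z_l V_l with V_l in
   SU(2) and Z_l = diag (z, z^* ), |z| = 1, that is, a z-rotation.  With
   V = V_1 (x) ... (x) V_n, the rotation Z = V K V^-1 inverts Hbar = V H V^-1.
   Exponentials are computed in an eigenbasis, where the matrix series reduces
   to the scalar series of cos t + i sin t. *)
From HB Require Import structures.
Require Import Defs.
From mathcomp Require Import all_boot all_order all_algebra.
From mathcomp Require Import all_classical all_reals all_analysis.
From mathcomp Require Import complex mxtens ring.

Set Implicit Arguments.
Unset Strict Implicit.
Unset Printing Implicit Defensive.

Import Order.TTheory GRing.Theory Num.Theory.
Import numFieldNormedType.Exports.

Local Open Scope classical_set_scope.
Local Open Scope ring_scope.
Local Open Scope sesquilinear_scope.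

(** * Real scalars inside the complex numbers, and the series of e^{it} *)

Section Cis.
Variable R : realType.
Local Notation C := (Cplx R).
Implicit Types (x t : R) (z : C).

(** [of_real] is the embedding of the reals retyped into [Cplx R], so its morphism structure is
    declared for this codomain. *)
Fact of_real_is_additive : additive (@of_real R).
Proof. exact: raddfB (real_complex R). Qed.

Fact of_real_is_monoid_morphism : monoid_morphism (@of_real R).
Proof.
split; first exact: rmorph1 (real_complex R).
exact: rmorphM (real_complex R).
Qed.

HB.instance Definition _ := GRing.isZmodMorphism.Build R C (@of_real R)
  of_real_is_additive.
HB.instance Definition _ := GRing.isMonoidMorphism.Build R C (@of_real R)
  of_real_is_monoid_morphism.


Lemma of_realP z : z \is Num.real -> exists x, z = of_real x.
Proof. by move=> /complex_realP[x ->]; exists x. Qed.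

Lemma normr_of_real x : `|of_real x| = of_real `|x|.
Proof. by have := normc_def (of_real x); rewrite /= expr0n addr0 sqrtr_sqr. Qed.

Lemma ltr_of_real x t : (of_real x < of_real t) = (x < t).
Proof. exact: ltcR. Qed.

Lemma conj_of_real x : (of_real x)^* = of_real x.
Proof. by apply/CrealP/complex_realP; exists x. Qed.

Lemma cvg_of_real (T : Type) (F : set_system T) (FF : Filter F) (f : T -> R) x :
  f y @[y --> F] --> x -> of_real (f y) @[y --> F] --> of_real x.
Proof.
move=> fx; apply/cvgrPdist_lt => e e0.
(* A positive element of the complex field is real, so the complex radius [e] comes from a real
   one. *)
have [r er] := of_realP (gtr0_real e0).
move: e0; rewrite er -(rmorph0 (@of_real R)) ltr_of_real => r0.
move: fx => /cvgrPdist_lt /(_ _ r0); apply: filterS => y.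
by rewrite -rmorphB normr_of_real ltr_of_real.
Qed.

Definition cis t : C := of_real (cos t) + 'i * of_real (sin t).

Lemma cisD s t : cis (s + t) = cis s * cis t.
Proof.
rewrite /cis cosD sinD !(rmorphD, rmorphB, rmorphM) /=.
have := @sqrCi C; set j := 'i => j2.
ring : j2.
Qed.

Lemma cis0 : cis 0 = 1.
Proof. by rewrite /cis cos0 sin0 rmorph1 rmorph0 mulr0 addr0. Qed.

Lemma conj_cis t : (cis t)^* = cis (- t).
Proof.
rewrite /cis rmorphD rmorphM /= conjCi !conj_of_real cosN sinN rmorphN /=.
by rewrite mulNr mulrN.
Qed.

Lemma cisVr t : cis t * cis (- t) = 1.
Proof. by rewrite -cisD subrr cis0. Qed.

(** The arc cosine of the real part gives an angle with nonnegative sine; the sign of the imaginary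
    part decides between this angle and its opposite. *)
Lemma cis_surj z : z * z^* = 1 -> exists t, z = cis t.
Proof.
rewrite -normCK normC2_Re_Im.
have [x zx] := of_realP (Creal_Re z); have [y zy] := of_realP (Creal_Im z).
rewrite [in X in _ -> X](Crect z) zx zy -!rmorphXn -rmorphD.
rewrite -(rmorph1 (@of_real R)).
move=> /(@complexI R) xy.
have x1 : -1 <= x <= 1.
  rewrite -ler_norml -(@ler_pXn2r _ 2%N) ?nnegrE// expr1n.
  by rewrite real_normK ?num_real// -xy lerDl sqr_ge0.
have s2 : Num.sqrt (1 - x ^+ 2) = `|y|.
  by rewrite -xy addrAC subrr add0r sqrtr_sqr.
have [y0|y0] := leP 0 y.
  by exists (acos x); rewrite /cis acosK ?in_itv// sin_acos// s2 ger0_norm.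
exists (- acos x); rewrite /cis cosN sinN acosK ?in_itv// sin_acos// s2.
by rewrite ltr0_norm// opprK.
Qed.

(** Splitting the powers of ['i] by parity of the exponent separates the cosine coefficients from
    the sine coefficients. *)
Lemma cis_coeff t k : (k`!%:R : C)^-1 * ('i * of_real t) ^+ k =
  of_real (cos_coeff t k) + 'i * of_real (sin_coeff t k).
Proof.
rewrite /cos_coeff /sin_coeff !rmorphM !fmorphV !rmorph_nat /= !rmorphXn.
rewrite rmorphN rmorph1 exprMn.
have ik : 'i ^+ k = (~~ odd k)%:R * (-1) ^+ k./2 +
    'i * ((odd k)%:R * (-1) ^+ k.-1./2) :> C.
  rewrite -[in LHS](odd_double_half k) exprD -mul2n exprM sqrCi.
  case: (boolP (odd k)) => ok /=; last by rewrite expr0 !mul0r mulr0 addr0.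
  (* The sine coefficients halve [k.-1]; for odd [k] this agrees with halving [k]. *)
  have -> : (k.-1./2 = k./2)%N.
    by case: k ok => //= k; rewrite uphalf_half => /negbTE ->.
  by rewrite expr1 mul0r add0r !mul1r.
by rewrite ik; ring.
Qed.

Lemma cvg_cis t :
  series (fun k => (k`!%:R : C)^-1 * ('i * of_real t) ^+ k) @ \oo --> cis t.
Proof.
have -> : series (fun k => (k`!%:R : C)^-1 * ('i * of_real t) ^+ k) =
    (fun n => of_real (series (cos_coeff t) n) +
              'i * of_real (series (sin_coeff t) n)).
  apply/funext => n; rewrite /series /= !rmorph_sum /= mulr_sumr -big_split /=.
  by apply: eq_bigr => k _; rewrite cis_coeff.
apply: cvgD; last apply: cvgMr.
  (* Unlocking exposes the cosine as the limit of its own series. *)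
  rewrite unlock; apply: cvg_of_real; exact: is_cvg_series_cos_coeff.
rewrite unlock; apply: cvg_of_real; exact: is_cvg_series_sin_coeff.
Qed.

Lemma continuous_cis : continuous cis.
Proof.
move=> t; apply: cvgD; last apply: cvgMr.
  by apply: cvg_of_real; exact: continuous_cos.
by apply: cvg_of_real; exact: continuous_sin.
Qed.

End Cis.

(** A neighbourhood of a matrix contains a product of neighbourhoods of its entries, and finitely
    many eventual conditions hold together eventually. *)
Lemma cvg_mx (K : numFieldType) (m n : nat) (T : Type) (F : set_system T)
    (FF : Filter F) (f : T -> 'M[K]_(m, n)) (M : 'M[K]_(m, n)) :
  (forall i j, f x i j @[x --> F] --> M i j) -> f x @[x --> F] --> M.
Proof.
move=> fM A [P MP PA]; rewrite /nbhs/=.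
have : \forall x \near F, forall ij : 'I_m * 'I_n, P ij.1 ij.2 (f x ij.1 ij.2).
  by apply: filter_forall => -[i j]; exact: fM (MP i j).
by apply: filterS => x Px; apply: PA => i j; exact: (Px (i, j)).
Qed.

(** * The conjugation action on matrices *)

Section AdTheory.
Variables (F : numClosedFieldType) (m : nat).
Implicit Types K H P : 'M[F]_m.

Lemma AdN K H : Ad K (- H) = - Ad K H.
Proof. by rewrite /Ad mulmxN mulNmx. Qed.

Lemma invmxM K P : K \in unitmx -> P \in unitmx ->
  invmx (K *m P) = invmx P *m invmx K.
Proof.
move=> Ku Pu; have KPu : K *m P \in unitmx by rewrite unitmx_mul Ku.
by rewrite -[RHS](mulmxK KPu) !mulmxA mulmxKV// mulVmx// mul1mx.
Qed.

Lemma AdM K P H : K \in unitmx -> P \in unitmx -> Ad (K *m P) H = Ad K (Ad P H).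
Proof. by move=> Ku Pu; rewrite /Ad invmxM// !mulmxA. Qed.

Lemma AdK K H : K \in unitmx -> Ad (invmx K) (Ad K H) = H.
Proof. by move=> Ku; rewrite /Ad invmxK !mulmxA mulVmx// mul1mx mulmxKV. Qed.

Lemma Ad_hamiltonian K H :
  K \is unitarymx -> hamiltonian H -> hamiltonian (Ad K H).
Proof.
move=> Ku [Hh Ht]; split; last first.
  by rewrite /Ad mxtrace_mulC mulKmx ?unitarymx_unit.
apply/is_hermitianmxP; rewrite expr0 scale1r /Ad invmx_unitary//.
rewrite !trmx_mul !map_mxM trmxCK mulmxA; congr (_ *m _ *m _).
by move: (is_hermitianmxP _ _ _ Hh); rewrite expr0 scale1r.
Qed.

End AdTheory.

(** * Diagonalised matrices and their exponential series *)

Lemma unitary_diag (C : numClosedFieldType) m (e : 'rV[C]_m) :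
  (diag_mx e \is unitarymx) <-> (forall j, e 0 j * (e 0 j)^* = 1).
Proof.
split=> [/unitarymxP + j|e1].
  rewrite tr_diag_mx map_diag_mx mulmx_diag => /matrixP/(_ j j).
  by rewrite !mxE eqxx.
apply/unitarymxP; rewrite tr_diag_mx map_diag_mx mulmx_diag -diag_const_mx.
by congr diag_mx; apply/rowP => j; rewrite !mxE e1.
Qed.

Section DiagConj.
Variables (C : numClosedFieldType) (m : nat).
Implicit Types (H K P : 'M[C]_m) (e : 'I_m -> C).

(** The eigenvalues form a function, so that sums, powers and limits act on them pointwise; the
    inverse stands on the left as in the spectral theorem. *)
Definition diag_conj P e : 'M[C]_m := invmx P *m diag_mx (\row_j e j) *m P.

(** Each entry is linear in the eigenvalues, with coefficients fixed by [P]; linearity and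
    continuity in [e] follow from this. *)
Lemma diag_conjE P e i j :
  diag_conj P e i j = \sum_l invmx P i l * P l j * e l.
Proof.
rewrite /diag_conj mul_mx_diag mxE; apply: eq_bigr => l _.
by rewrite !mxE mulrAC.
Qed.

Lemma eq_diag_conj P e1 e2 : e1 =1 e2 -> diag_conj P e1 = diag_conj P e2.
Proof. by move=> /funext ->. Qed.

Lemma diag_conjZ a P e : a *: diag_conj P e = diag_conj P (fun j => a * e j).
Proof.
apply/matrixP => i j; rewrite mxE !diag_conjE mulr_sumr.
by apply: eq_bigr => l _; rewrite mulrCA.
Qed.

Lemma diag_conj_sum (I : Type) (r : seq I) P (e : I -> 'I_m -> C) :
  \sum_(k <- r) diag_conj P (e k) = diag_conj P (fun j => \sum_(k <- r) e k j).
Proof.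
apply/matrixP => i j; rewrite summxE diag_conjE.
under eq_bigr do rewrite diag_conjE.
by rewrite exchange_big; apply: eq_bigr => l _; rewrite mulr_sumr.
Qed.

Lemma diag_conj1 P : P \in unitmx -> diag_conj P (fun=> 1) = 1%:M.
Proof.
move=> Pu; rewrite /diag_conj (_ : \row_j _ = const_mx 1); last first.
  by apply/rowP => j; rewrite !mxE.
by rewrite diag_const_mx mulmx1 mulVmx.
Qed.

Lemma diag_conjM P e1 e2 : P \in unitmx ->
  diag_conj P e1 *m diag_conj P e2 = diag_conj P (fun j => e1 j * e2 j).
Proof.
move=> Pu; rewrite /diag_conj !mulmxA mulmxK//.
rewrite -(mulmxA _ (diag_mx _) (diag_mx _)) mulmx_diag.
by congr (_ *m diag_mx _ *m _); apply/rowP => j; rewrite !mxE.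
Qed.

Lemma diag_conjX P e k : P \in unitmx ->
  diag_conj P e ^+ k = diag_conj P (fun j => e j ^+ k).
Proof.
move=> Pu; elim: k => [|k IH]; first by rewrite expr0 diag_conj1.
rewrite exprS IH; apply: etrans (diag_conjM _ _ Pu) _.
by congr diag_conj; apply/funext => j; rewrite exprS.
Qed.

(** Conjugation changes the eigenbasis and keeps the eigenvalues. *)
Lemma Ad_diag_conj K P e : K \in unitmx -> P \in unitmx ->
  Ad K (diag_conj P e) = diag_conj (P *m invmx K) e.
Proof.
by move=> Ku Pu; rewrite /Ad /diag_conj invmxM ?unitmx_inv// invmxK !mulmxA.
Qed.

Lemma diag_conj_unitary P e : P \is unitarymx ->
  (forall j, e j * (e j)^* = 1) -> diag_conj P e \is unitarymx.
Proof.
move=> Pu e1; apply: mul_unitarymx => //; apply: mul_unitarymx.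
  by rewrite invmx_unitary// trmxC_unitary.
by apply/unitary_diag => j; rewrite mxE.
Qed.

Lemma normal_diag_conj H : H \is normalmx ->
  exists2 P, P \is unitarymx & H = diag_conj P (fun j => spectral_diag H 0 j).
Proof.
move=> /orthomx_spectralP HE; exists (spectralmx H).
  exact: spectral_unitarymx.
rewrite {1}HE /diag_conj; congr (_ *m diag_mx _ *m _).
by apply/rowP => j; rewrite mxE.
Qed.

Lemma cvg_diag_conj (T : Type) (F : set_system T) (FF : Filter F) P
    (f : 'I_m -> T -> C) (l : 'I_m -> C) :
  (forall j, f j x @[x --> F] --> l j) ->
  diag_conj P (fun j => f j x) @[x --> F] --> diag_conj P l.
Proof.
move=> fl; apply: cvg_mx => i j; rewrite diag_conjE.
under eq_cvg do rewrite diag_conjE.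
apply: cvg_big => [|k _]; first exact: add_continuous.
exact: cvgMl_tmp.
Qed.

Lemma expmx_diag_conj P e (l : 'I_m -> C) : P \in unitmx ->
  (forall j, series (fun k => (k`!%:R : C)^-1 * e j ^+ k) @ \oo --> l j) ->
  expmx (diag_conj P e) = diag_conj P l.
Proof.
(* Limits are unique in a separated space, so it suffices to show that the partial sums converge to
   the claimed value. *)
move=> Pu el; apply: cvg_lim; first exact: norm_hausdorff.
have -> : series (fun k => (k`!%:R : C)^-1 *: diag_conj P e ^+ k) =
    (fun n => diag_conj P
       (fun j => series (fun k => (k`!%:R : C)^-1 * e j ^+ k) n)).
  apply/funext => n; rewrite /series /=.
  under eq_bigr do rewrite diag_conjX// diag_conjZ.
  by rewrite diag_conj_sum.
exact: cvg_diag_conj.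
Qed.

End DiagConj.

(** * Exponentials of Hermitian matrices *)

Section Exponential.
Variable R : realType.
Local Notation C := (Cplx R).
Variable m : nat.
Implicit Types (H K P : 'M[C]_m) (d : 'I_m -> R) (t : R).

Lemma hermitian_diag_conj H : H \is hermsymmx -> exists d,
  exists2 P, P \is unitarymx & H = diag_conj P (fun j => of_real (d j)).
Proof.
move=> Hh; have [P Pu HE] := normal_diag_conj (hermitian_normalmx Hh).
have /mxOverP dr := hermitian_spectral_diag_real Hh.
have /choice[d dE] : forall j, exists x, spectral_diag H 0 j = of_real x.
  by move=> j; exact: of_realP (dr 0 j).
exists d, P; first exact: Pu.
by apply: etrans HE _; exact: eq_diag_conj.
Qed.

(** [P] is only assumed invertible, so that the formula also covers the basis [P *m invmx K] of a
    conjugated matrix. *)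
Lemma expmx_cis P d t : P \in unitmx ->
  expmx (('i * of_real t) *: diag_conj P (fun j => of_real (d j))) =
  diag_conj P (fun j => cis (t * d j)).
Proof.
move=> Pu; rewrite diag_conjZ; apply: expmx_diag_conj => // j.
by rewrite -mulrA -rmorphM; exact: cvg_cis.
Qed.

Lemma expmx_Ad K H t : K \in unitmx -> H \is hermsymmx ->
  expmx (('i * of_real t) *: Ad K H) = Ad K (expmx (('i * of_real t) *: H)).
Proof.
move=> Ku /hermitian_diag_conj[d [P /unitarymx_unit Pu ->]].
rewrite Ad_diag_conj// !expmx_cis ?Ad_diag_conj//.
by rewrite unitmx_mul Pu unitmx_inv.
Qed.

(** In a fixed eigenbasis the evolution acts by [cis (- t * d j)], so every group property reduces
    to one of [cis]. *)
Lemma evolution_unitary_group H : H \is hermsymmx ->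
  one_parameter_unitary_group (evolution H).
Proof.
move=> /hermitian_diag_conj[d [P Pu ->]]; have Pu' := unitarymx_unit Pu.
set U := evolution _.
have UE : U = fun t => diag_conj P (fun j => cis (- t * d j)).
  by apply/funext => t; rewrite /U /evolution -mulrN -rmorphN expmx_cis.
rewrite UE; split=> [t||s t|t].
- by apply: diag_conj_unitary => // j; rewrite conj_cis cisVr.
- apply: etrans (diag_conj1 Pu'); apply: eq_diag_conj => j.
  by rewrite oppr0 mul0r cis0.
- apply/esym; apply: etrans (diag_conjM _ _ Pu') _; apply: eq_diag_conj => j /=.
  by rewrite -cisD opprD mulrDl.
apply: cvg_diag_conj => j.
have tj : (- s * d j) @[s --> t] --> - t * d j.
  by apply: cvgMr_tmp; apply: cvgN; exact: cvg_id.
exact: cvg_comp tj (@continuous_cis R _).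
Qed.

End Exponential.

(** * Tensor products of unitaries, and diagonalisation in SU(2) *)

Section LocalUnitaries.
Variable C : numClosedFieldType.

(** With the dimension equation abstract, eliminating it turns the casts, as used by [bigtens], into
    identities. *)
Lemma castmx_mulmx (R : pzSemiRingType) m m' (e : m = m') (A B : 'M[R]_m) :
  castmx (e, e) A *m castmx (e, e) B = castmx (e, e) (A *m B).
Proof. by case: m' / e; rewrite !castmx_id. Qed.

Lemma castmx1 (R : pzSemiRingType) m m' (e : m = m') :
  castmx (e, e) (1%:M : 'M[R]_m) = 1%:M.
Proof. by case: m' / e; rewrite castmx_id. Qed.

Lemma tensmx11 (R : pzRingType) m n :
  (1%:M : 'M[R]_m) *t (1%:M : 'M[R]_n) = 1%:M.
Proof.
apply/matrixP => i j.
case: (mxtens_indexP i) => i0 i1; case: (mxtens_indexP j) => j0 j1.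
rewrite tensmxE !mxE (can_eq (@mxtens_indexK m n)) xpair_eqE /=.
by do 2 case: eqVneq => _; rewrite ?(mulr1, mulr0).
Qed.

Lemma bigtensM n (K L : 'I_n -> 'M[C]_2) :
  bigtens K *m bigtens L = bigtens (fun l => K l *m L l).
Proof.
elim: n K L => [|n IH] K L /=; first by rewrite mulmx1.
by rewrite castmx_mulmx tensmx_mul IH.
Qed.

Lemma bigtens1 n : bigtens (fun _ : 'I_n => 1%:M : 'M[C]_2) = 1%:M.
Proof. by elim: n => //= n ->; rewrite tensmx11 castmx1. Qed.

Lemma bigtens_adj n (K : 'I_n -> 'M[C]_2) :
  (bigtens K)^t* = bigtens (fun l => (K l)^t*).
Proof.
elim: n K => [|n IH] K /=; first by rewrite trmx1 map_mx1.
by rewrite trmx_cast map_castmx trmx_tens map_mxT IH.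
Qed.

Lemma bigtens_unitary n (K : 'I_n -> 'M[C]_2) :
  (forall l, K l \is unitarymx) -> bigtens K \is unitarymx.
Proof.
move=> Ku; apply/unitarymxP; rewrite bigtens_adj bigtensM -bigtens1.
by congr bigtens; apply/funext => l; exact/unitarymxP.
Qed.

(** For unitaries the inverse is the adjoint, which already acts factor by factor. *)
Lemma invmx_bigtens n (K : 'I_n -> 'M[C]_2) : (forall l, K l \is unitarymx) ->
  invmx (bigtens K) = bigtens (fun l => invmx (K l)).
Proof.
move=> Ku; rewrite invmx_unitary ?bigtens_unitary// bigtens_adj.
by congr bigtens; apply/funext => l; rewrite invmx_unitary.
Qed.

Lemma SUM m (K L : 'M[C]_m) : SU K -> SU L -> SU (K *m L).
Proof.
move=> [Ku K1] [Lu L1]; split; first exact: mul_unitarymx.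
by rewrite det_mulmx K1 L1 mulr1.
Qed.

Lemma SUV m (K : 'M[C]_m) : SU K -> SU (invmx K).
Proof.
move=> [Ku K1]; split; first by rewrite invmx_unitary// trmxC_unitary.
by rewrite det_inv K1 invr1.
Qed.

Lemma localSU_unitary n (K : 'M[C]_(2 ^ n)) : localSU K -> K \is unitarymx.
Proof. by move=> [Kl KlSU ->]; apply: bigtens_unitary => l; case: (KlSU l). Qed.

Lemma localSUM n (K L : 'M[C]_(2 ^ n)) :
  localSU K -> localSU L -> localSU (K *m L).
Proof.
move=> [Kl KSU ->] [Ll LSU ->]; exists (fun l => Kl l *m Ll l).
  by move=> l; exact: SUM.
exact: bigtensM.
Qed.

Lemma localSUV n (K : 'M[C]_(2 ^ n)) : localSU K -> localSU (invmx K).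
Proof.
move=> [Kl KSU ->]; exists (fun l => invmx (Kl l)).
  by move=> l; exact: SUV.
by rewrite invmx_bigtens// => l; case: (KSU l).
Qed.

Lemma unitary_det m (K : 'M[C]_m) : K \is unitarymx -> \det K * (\det K)^* = 1.
Proof.
move=> /unitarymxP /(congr1 determinant); rewrite det_mulmx det1 => <-.
by rewrite det_map_mx det_tr.
Qed.

Definition diag2 (a b : C) : 'M[C]_2 :=
  diag_mx (\row_j if j == ord0 then a else b).

Lemma diag2_SU (z : C) : z * z^* = 1 -> SU (diag2 z z^*).
Proof.
move=> z1; split; last by rewrite det_diag big_ord_recl big_ord1 !mxE.
by apply/unitary_diag => j; rewrite mxE; case: ifP => // _; rewrite conjCK mulrC.
Qed.

(** A unitary matrix is normal, hence diagonalisable by a unitary; its two eigenvalues have modulus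
    1 and product 1, so they are conjugate. *)
Lemma SU2_diag (K : 'M[C]_2) : SU K -> exists V z,
  [/\ SU V, z * z^* = 1 & K = invmx V *m diag2 z z^* *m V].
Proof.
move=> [Ku K1].
have Kn : K \is normalmx.
  apply/normalmxP; rewrite (unitarymxP Ku) -invmx_unitary//.
  by rewrite mulVmx// unitarymx_unit.
have [P Pu KE] := normal_diag_conj Kn; have Pu' := unitarymx_unit Pu.
move: (fun j => _) KE => e KE.
have De : diag_mx (\row_j e j) = P *m K *m invmx P.
  by rewrite KE /diag_conj !mulmxA mulmxV// mul1mx mulmxK.
have /unitary_diag e1 : diag_mx (\row_j e j) \is unitarymx.
  rewrite De mul_unitarymx ?mul_unitarymx//.
  by rewrite invmx_unitary// trmxC_unitary.
have ee : e ord0 * e (lift ord0 ord0) = 1.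
  have := congr1 determinant De.
  rewrite !det_mulmx det_inv K1 mulr1 mulrV -?unitmxE//.
  by rewrite det_diag big_ord_recl big_ord1 !mxE.
have DE : diag_mx (\row_j e j) = diag2 (e ord0) (e ord0)^*.
  congr diag_mx; apply/rowP => j; rewrite !mxE; case: ifP => [/eqP-> //|j0].
  have -> : j = lift ord0 ord0 by apply/val_inj; case: j j0 => [[|[|]]].
  (* The conjugate of the first eigenvalue and the second eigenvalue are both inverse to the first,
     so cancelling it identifies them. *)
  have := e1 ord0; rewrite mxE -[RHS]ee => /mulfI -> //.
  by apply/eqP => e0; move: ee; rewrite e0 mul0r => /esym/eqP; rewrite oner_eq0.
(* [P] need not have determinant 1; the diagonal [W] corrects this and commutes
   with the diagonal form of [K]. *)
pose W := diag2 1 (\det P)^*.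
have dP := unitary_det Pu.
have Wu : W \is unitarymx.
  apply/unitary_diag => j; rewrite mxE.
  by case: ifP => _; rewrite ?conjC1 ?mulr1// conjCK mulrC.
have Wu' := unitarymx_unit Wu.
exists (W *m P), (e ord0); split.
- split; first exact: mul_unitarymx.
  by rewrite det_mulmx det_diag big_ord_recl big_ord1 !mxE mul1r mulrC.
- by have := e1 ord0; rewrite mxE.
rewrite -DE invmxM// !mulmxA -(mulmxA _ _ W) [diag_mx _ *m W]diag_mxC.
by rewrite mulmxA mulmxKV.
Qed.

Lemma localSU_diag n (K : 'M[C]_(2 ^ n)) : localSU K -> exists2 V, localSU V &
  exists2 z : 'I_n -> C, forall l, z l * (z l)^* = 1 &
    K = invmx V *m bigtens (fun l => diag2 (z l) (z l)^*) *m V.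
Proof.
move=> [Kl KSU ->].
have /choice[V /choice[z VzE]] := fun l => SU2_diag (KSU l).
exists (bigtens V); first by exists V => // l; case: (VzE l).
exists z; first by move=> l; case: (VzE l).
rewrite invmx_bigtens; last by move=> l; case: (VzE l) => -[].
by rewrite !bigtensM; congr bigtens; apply/funext => l; case: (VzE l).
Qed.

End LocalUnitaries.

(** * The z-rotations as the diagonal matrices of SU(2) *)

Section ZRotations.
Variable R : realType.
Local Notation C := (Cplx R).

(** [sigma_z] is diagonal already, so the exponential formula applies in the identity basis with
    eigenvalues 1 and -1. *)
Lemma z_rotationE (phi : R) :
  z_rotation phi = diag2 (cis (- (phi / 2))) (cis (- (phi / 2)))^*.
Proof.
pose s (j : 'I_2) : R := if j == ord0 then 1 else -1.
have sE : sigma_z C = diag_conj 1%:M (fun j => of_real (s j)).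
  rewrite /diag_conj invmx1 mul1mx mulmx1; congr diag_mx; apply/rowP => j.
  by rewrite !mxE /s; case: ifP; rewrite ?rmorphN rmorph1.
rewrite /z_rotation sE -mulrN -rmorphN expmx_cis; last exact: unitmx1.
rewrite /diag_conj invmx1 mul1mx mulmx1; congr diag_mx; apply/rowP => j.
by rewrite !mxE /s; case: ifP; rewrite ?mulr1// mulrN1 conj_cis.
Qed.

Lemma z_rotation_SU (phi : R) : SU (z_rotation phi).
Proof. by rewrite z_rotationE; apply: diag2_SU; rewrite conj_cis cisVr. Qed.

Lemma localSU_z_rotations n (phi : 'I_n -> R) :
  localSU (bigtens (fun l => z_rotation (phi l))).
Proof. by exists (fun l => z_rotation (phi l)) => // l; exact: z_rotation_SU. Qed.

Lemma diag2_z_rotation (z : C) : z * z^* = 1 ->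
  exists phi : R, diag2 z z^* = z_rotation phi.
Proof.
(* The factor -2 undoes the halving and the sign in the exponent of a rotation. *)
move=> /cis_surj[t ->]; exists (- (t * 2)).
by rewrite z_rotationE mulNr opprK mulfK.
Qed.

Lemma localSU_diag_z_rotations n (K : 'M[C]_(2 ^ n)) : localSU K ->
  exists2 V, localSU V & exists phi : 'I_n -> R,
    K = invmx V *m bigtens (fun l => z_rotation (phi l)) *m V.
Proof.
move=> /localSU_diag[V VSU [z z1 KE]]; exists V; first exact: VSU.
have /choice[phi phiE] := fun l => diag2_z_rotation (z1 l).
by exists phi; rewrite -(funext phiE); exact: KE.
Qed.

(** The exponential commutes with conjugation, so an inversion of the generator passes to the group
    with the same [K] at all times. *)
Lemma typeI_group n (H : 'M[C]_(2 ^ n)) : hamiltonian H ->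
  locally_invertible_typeI H -> group_locally_invertible_typeI H.
Proof.
move=> [Hh _] [K KSU KH]; exists K => // t.
have Ku := unitarymx_unit (localSU_unitary KSU).
have iN : - ('i * of_real t) = 'i * of_real (- t) :> C.
  by rewrite rmorphN mulrN.
rewrite /evolution iN -(expmx_Ad (- t) Ku Hh).
by rewrite KH -iN scalerN scaleNr opprK.
Qed.

End ZRotations.

(** * Both directions of the orbit characterisation *)

Theorem corollary1 (R : realType) (n : nat) :
  (forall Hbar H : 'M[Cplx R]_(2 ^ n),
     hamiltonian Hbar -> invertible_by_z_rotations Hbar ->
     hamiltonian H -> local_orbit Hbar H ->
     [/\ one_parameter_unitary_group (evolution H),
         locally_invertible_typeI H
       & group_locally_invertible_typeI H])
  /\
  (forall H : 'M[Cplx R]_(2 ^ n),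
     hamiltonian H -> locally_invertible_typeI H ->
     exists Hbar : 'M[Cplx R]_(2 ^ n),
       [/\ hamiltonian Hbar, invertible_by_z_rotations Hbar
         & local_orbit Hbar H]).
Proof.
split=> [Hbar H _ [phi Hphi] hH [K KSU KE]|H hH [K KSU KE]].
  have ZSU := localSU_z_rotations phi; set Z := bigtens _ in ZSU Hphi.
  have Ku := unitarymx_unit (localSU_unitary KSU).
  have Zu := unitarymx_unit (localSU_unitary ZSU).
  have typeI : locally_invertible_typeI H.
    exists (K *m Z *m invmx K).
      by apply: localSUM (localSUV KSU); exact: localSUM.
    (* With [H] read as [Ad K Hbar], the conjugator K Z K^-1 K collapses to K Z, and the sign
       produced by [Z] passes through [Ad K]. *)
    rewrite -KE -AdM ?unitmx_mul ?Ku ?Zu ?unitmx_inv// mulmxKV// AdM//.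
    by rewrite Hphi AdN.
  split=> //; last exact: typeI_group.
  by case: hH => Hh _; exact: evolution_unitary_group.
have [V VSU [phi KV]] := localSU_diag_z_rotations KSU.
have Vu := unitarymx_unit (localSU_unitary VSU).
have Zu := unitarymx_unit (localSU_unitary (localSU_z_rotations phi)).
exists (Ad V H); split.
- exact: Ad_hamiltonian (localSU_unitary VSU) hH.
(* Replacing [- H] by [Ad K H] leaves two conjugations of [H], by Z V and by V (V^-1 Z V) with Z the
   tensor of rotations, and these agree. *)
- exists phi; rewrite -AdM// -AdN -KE KV -AdM ?unitmx_mul ?unitmx_inv ?Vu ?Zu//.
  by rewrite !mulmxA mulmxV// mul1mx.
exists (invmx V); first exact: localSUV.
exact: AdK.
Qed.
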